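(* Let $A\colon\mathbb{R}^n\to\mathbb{R}^m$ be a linear mapping of rank $n$, let $b\in\mathbb{R}^m$, and suppose that $E_{A,b}=\{x\in\mathbb{R}^n\mid Ax\le b\}$ is a (nonempty, possibly unbounded) polyhedron. Let $c\in\mathbb{R}^n$. Then the functional $f(x)=c^Tx$ attains its minimum on $E_{A,b}$ if and only if $$-c\in\bigcup_{w\in E_{A,b}^*}N_w(E_{A,b}).$$ In particular, the minimum is attained at those vertices $w\in E_{A,b}^*$ for which $-c\in N_w(E_{A,b})$.
   Context: Inequalities between vectors are coordinatewise, and $\langle\cdot,\cdot\rangle$ is the usual inner product. For a closed convex set $F\subset\mathbb{R}^n$, $F^*$ denotes the set of extremal points (vertices) of $F$: $x_0\in F^*$ iff $x_0\in F$ and whenever $x_0=(1-t)x_1+tx_2$ with $x_1,x_2\in F$, $t\in(0,1)$, one has $x_1=x_2$. For $E\subset\mathbb{R}^n$ and $a\in E$, the Peano tangent cone is $$C_a(E)=\{v\in\mathbb{R}^n\mid \exists\, (x_\nu)\subset E,\ x_\nu\to a,\ \lambda_\nu>0\colon \lambda_\nu(x_\nu-a)\to v\}$$ (for an isolated point $a$ of $E$ this gives $C_a(E)=\{0\}$), and the normal cone is $$N_a(E)=\{w\in\mathbb{R}^n\mid \forall v\in C_a(E),\ \langle v,w\rangle\le 0\}.$$ *)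

(* Defs.v *)
From mathcomp Require Import all_boot all_order all_algebra.
From mathcomp Require Import all_classical all_reals all_analysis.

Set Implicit Arguments.
Unset Strict Implicit.
Unset Printing Implicit Defensive.

Import Order.TTheory GRing.Theory Num.Theory.
Import numFieldNormedType.Exports.

Local Open Scope classical_set_scope.
Local Open Scope ring_scope.

Definition inner (R : realType) (n : nat) (u v : 'cV[R]_n) : R :=
  (u^T *m v) 0 0.

Definition polyhedron (R : realType) (m n : nat) (A : 'M[R]_(m, n))
    (b : 'cV[R]_m) : set 'cV[R]_n :=
  [set x | forall i : 'I_m, (A *m x) i 0 <= b i 0].

Definition extremal_points (R : realType) (n : nat) (F : set 'cV[R]_n) :
    set 'cV[R]_n :=
  [set x0 | F x0 /\
    forall (x1 x2 : 'cV[R]_n) (t : R), F x1 -> F x2 -> 0 < t < 1 ->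
      x0 = (1 - t) *: x1 + t *: x2 -> x1 = x2].

(* Convergence in 'cV[R]_n is entrywise. For a outside the closure of E the
   set below is empty; it is only meant for points a of E. *)
Definition tangent_cone (R : realType) (n : nat) (E : set 'cV[R]_n)
    (a : 'cV[R]_n) : set 'cV[R]_n :=
  [set v | exists (x : nat -> 'cV[R]_n) (lam : nat -> R),
    [/\ forall k, E (x k),
        x k @[k --> \oo] --> a,
        forall k, 0 < lam k
      & lam k *: (x k - a) @[k --> \oo] --> v]].

Definition normal_cone (R : realType) (n : nat) (E : set 'cV[R]_n)
    (a : 'cV[R]_n) : set 'cV[R]_n :=
  [set w | forall v, tangent_cone E a v -> inner v w <= 0].

Definition attains_min_at (R : realType) (n : nat) (f : 'cV[R]_n -> R)
    (E : set 'cV[R]_n) (x0 : 'cV[R]_n) : Prop :=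
  E x0 /\ forall x, E x -> f x0 <= f x.

(* Main.v *)
Require Import Defs.
From mathcomp Require Import all_boot all_order all_algebra.
From mathcomp Require Import all_classical all_reals all_analysis.
From mathcomp Require Import lra.

Import Order.TTheory GRing.Theory Num.Theory.
Import numFieldNormedType.Exports.

Local Open Scope classical_set_scope.
Local Open Scope ring_scope.

(** For w and x in the convex set E, the vector x - w is tangent to E at w; so if
    -c is normal to E at w, then <c, x - w> >= 0 for every x in E, that is, w
    minimizes <c, .> over E.  Conversely, at a minimizer w the inequality
    <c, x - w> >= 0 passes to positive multiples and limits, hence to all
    tangent vectors, so -c is normal to E at w.  Thus, over a convex set,
    normality of -c at w and minimality of <c, .> at w are the same thing
    ([normal_cone_attains_min], [attains_min_normal_cone]).

    It remains to find a minimizer that is an extremal point, as soon as there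
    is any minimizer x ([exists_extremal_minimizer]).  If x is not extremal, it
    is interior to a nondegenerate segment [x1, x2] of E; then <c, .> and the
    constraints active at x are constant on the segment, as x minimizes the
    former and maximizes the latter.  Since A has rank n, some other constraint
    varies along the segment; following the line in the direction in which it
    increases, a further constraint becomes active at the last point of the
    line in E, while the old ones remain active and the value of <c, .> does
    not change.  Only m constraints are available, so this process ends, at an
    extremal minimizer. *)

Section Inner.
Context {R : realType} {n : nat}.
Implicit Types u v w : 'cV[R]_n.

Lemma innerDr u v w : inner u (v + w) = inner u v + inner u w.
Proof. by rewrite /inner mulmxDr mxE. Qed.

Lemma innerZr a u v : inner u (a *: v) = a * inner u v.
Proof. by rewrite /inner -scalemxAr mxE. Qed.

Lemma innerNr u v : inner u (- v) = - inner u v.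
Proof. by rewrite /inner mulmxN mxE. Qed.

Lemma innerBr u v w : inner u (v - w) = inner u v - inner u w.
Proof. by rewrite innerDr innerNr. Qed.

Lemma innerC u v : inner u v = inner v u.
Proof.
by rewrite /inner !mxE; apply: eq_bigr => i _; rewrite !mxE mulrC.
Qed.

Lemma inner_continuous u : continuous (inner u).
Proof.
rewrite (_ : inner u = fun v => \sum_i u i 0 * v i 0); last first.
  by apply/funext => v; rewrite /inner mxE; apply: eq_bigr => i _; rewrite mxE.
have cont_add : continuous (fun z : R * R => z.1 + z.2).
  by move=> z; apply: cvgD; [exact: cvg_fst|exact: cvg_snd].
apply: (continuous_big cont_add) => i _ v.
apply: (@continuous_comp _ _ _ (fun v : 'cV[R]_n => v i 0) ( *%R (u i 0))).
  exact: coord_continuous.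
exact: mulrl_continuous.
Qed.

End Inner.

Section NormalCone.
Context {R : realType} {n : nat}.
Implicit Types (E : set 'cV[R]_n) (c v w x : 'cV[R]_n).

(** Homotheties of ratio 1 / (k + 1) centered at w move x to points of E that
    tend to w, and rescaling by k + 1 gives back x - w. *)
Lemma tangent_cone_feasible {E w x} :
  (forall t, 0 < t <= 1 -> E (w + t *: (x - w))) -> tangent_cone E w (x - w).
Proof.
move=> Ewx; exists (fun k => w + k.+1%:R^-1 *: (x - w)), (fun k => k.+1%:R).
split=> //.
- by move=> k; apply: Ewx; rewrite invr_gt0 ltr0n/= invf_le1 ?ler1n ?ltr0n.
- rewrite -[X in _ --> X]addr0; apply: cvgD; first exact: cvg_cst.
  rewrite -[X in _ --> X](scale0r (x - w)); apply: cvgZr_tmp.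
  exact: cvg_harmonic.
- under eq_fun => k do
    rewrite addrAC subrr add0r scalerA mulfV ?pnatr_eq0// scale1r.
  exact: cvg_cst.
Qed.

(** When E is star-shaped at w, as a convex set is at each of its points, all
    the differences x - w are tangent to E at w. *)
Lemma normal_cone_attains_min E c w :
    (forall x t, E x -> 0 < t <= 1 -> E (w + t *: (x - w))) ->
    E w -> normal_cone E w (- c) -> attains_min_at (inner c) E w.
Proof.
move=> Estar Ew Nw; split=> // x Ex.
have /Nw := tangent_cone_feasible (fun t => Estar x t Ex).
by rewrite innerNr innerC innerBr oppr_le0 subr_ge0.
Qed.

(** A tangent vector v is a limit of positive multiples of differences x - w
    with x in E; on these <c, .> is nonnegative, hence also at v. *)
Lemma attains_min_normal_cone E c w :
  attains_min_at (inner c) E w -> normal_cone E w (- c).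
Proof.
move=> [_ minw] v [x [lam [Ex _ lam_gt0 lamv]]].
rewrite innerNr oppr_le0 innerC.
have cv : inner c (lam k *: (x k - w)) @[k --> \oo] --> inner c v.
  exact: continuous_cvg (inner_continuous c v) lamv.
apply: (@closed_cvg _ _ _ _ _ _ (closed_ge (y := 0)) _ _ cv).
near=> k => /=.
have := minw _ (Ex k); rewrite innerZr innerBr -subr_ge0.
exact/mulr_ge0/ltW/lam_gt0.
Unshelve. all: by end_near.
Qed.

End NormalCone.

(** A linear function that attains its maximum at an interior point of a
    segment is constant on it: this is used both for the active constraints
    and for the opposite of the objective. *)
Lemma convex_comb_eq_max {R : realFieldType} {p q r t : R} :
  p <= r -> q <= r -> 0 < t < 1 -> (1 - t) * p + t * q = r -> p = r /\ q = r.
Proof.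
move=> pr qr /andP[t0 t1] e.
have : (1 - t) * (r - p) + t * (r - q) == 0 by apply/eqP; rewrite -e; lra.
rewrite paddr_eq0 ?mulr_ge0 ?subr_ge0 ?(ltW t0) ?(ltW t1)//.
rewrite !mulf_eq0 !subr_eq0 (gt_eqF t1) (gt_eqF t0)/= => /andP[].
by move=> /eqP -> /eqP ->.
Qed.

Section Polyhedron.
Context {R : realType} {m n : nat} {A : 'M[R]_(m, n)} {b : 'cV[R]_m}.
Local Notation E := (polyhedron A b).
Implicit Types (x d : 'cV[R]_n).

Lemma mulmx_lineE p (M : 'M[R]_(p, n)) x d t i :
  (M *m (x + t *: d)) i 0 = (M *m x) i 0 + t * (M *m d) i 0.
Proof. by rewrite mulmxDr -scalemxAr !mxE. Qed.

Lemma polyhedron_convex {x y t} :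
  E x -> E y -> 0 < t <= 1 -> E (x + t *: (y - x)).
Proof.
move=> Ex Ey /andP[t0 t1] i; rewrite mulmx_lineE mulmxBr !mxE.
have := Ex i; have := Ey i; rewrite !mxE; nra.
Qed.

Definition active x : {set 'I_m} := [set i | (A *m x) i 0 == b i 0].

Lemma active_segment {x1 x2 t i} : E x1 -> E x2 -> 0 < t < 1 ->
  i \in active ((1 - t) *: x1 + t *: x2) -> (A *m (x2 - x1)) i 0 = 0.
Proof.
move=> E1 E2 t01; rewrite inE mulmxDr -!scalemxAr mxE.
rewrite [X in X + _]mxE [X in _ + X]mxE => /eqP e.
have [e1 e2] := convex_comb_eq_max (E1 i) (E2 i) t01 e.
by rewrite mulmxBr mxE [X in _ + X]mxE e1 e2 subrr.
Qed.

(** The constraints that increase along the line are the only ones that can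
    block it; the first of them to be saturated, given by the least ratio of
    slack to speed, tells how far one can go. *)
Lemma line_exit x d : E x ->
    (forall i, i \in active x -> (A *m d) i 0 = 0) ->
    (exists i, 0 < (A *m d) i 0) ->
  exists s, E (x + s *: d) /\ active x \proper active (x + s *: d).
Proof.
move=> Ex act0 [i0 di0].
pose ratio i := (b i 0 - (A *m x) i 0) / (A *m d) i 0.
have [j dj jmin] :=
  arg_minP (P := fun i => 0 < (A *m d) i 0) ratio di0.
have ratioj_ge0 : 0 <= ratio j by rewrite divr_ge0 ?subr_ge0 ?(ltW dj).
exists (ratio j); split=> [i|].
  rewrite mulmx_lineE -lerBrDl; have [di|di] := ltP 0 ((A *m d) i 0).
    by rewrite -ler_pdivlMr// jmin.
  by apply: (@le_trans _ _ 0); [exact: mulr_ge0_le0|rewrite subr_ge0].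
apply/fintype.properP; split.
  apply/fintype.subsetP => i ix; move: (ix); rewrite !inE mulmx_lineE.
  by rewrite (act0 _ ix) mulr0 addr0.
exists j; first by rewrite inE mulmx_lineE divfK ?lt0r_neq0// [eqbLHS]addrC subrK.
by apply/negP => /act0 dj0; rewrite dj0 ltxx in dj.
Qed.

(** The map A is injective, so some constraint varies along the segment; it is
    made to increase by replacing the direction d = x2 - x1 with - d if
    necessary, which is why the sign of s is left open. *)
Lemma segment_exit {x1 x2 t} (x := (1 - t) *: x1 + t *: x2) :
    \rank A = n -> E x1 -> E x2 -> 0 < t < 1 -> x1 <> x2 ->
  exists s, E (x + s *: (x2 - x1)) /\
    active x \proper active (x + s *: (x2 - x1)).
Proof.
move=> rankA E1 E2 t01 x12; set d := x2 - x1.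
have Ex : E x.
  rewrite (_ : x = x1 + t *: (x2 - x1)); last first.
    by rewrite /x scalerBl scale1r scalerBr addrA addrAC.
  by apply: polyhedron_convex => //; move: t01 => /andP[-> /ltW].
have act0 i : i \in active x -> (A *m d) i 0 = 0 by exact: active_segment.
have [i Adi] : exists i, (A *m d) i 0 != 0.
  apply: contra_notP x12 => /forallNP Ad0.
  have {}Ad0 : A *m d = 0.
    apply/matrixP => i j; rewrite (ord1 j) [RHS]mxE.
    by apply/eqP; have /negP := Ad0 i; rewrite negbK.
  have freeA : row_free A^T by rewrite /row_free mxrank_tr rankA.
  apply/esym/eqP; rewrite -subr_eq0 -trmx_eq0; apply/eqP.
  by apply: (row_free_inj freeA); rewrite mul0mx -trmx_mul Ad0 trmx0.
have [Adi_gt0|Adi_le0] := ltP 0 ((A *m d) i 0).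
  by apply: line_exit => //; exists i.
have [||s] := @line_exit x (- d) Ex.
- by move=> k /act0 Adk; rewrite mulmxN mxE Adk oppr0.
- by exists i; rewrite mulmxN mxE oppr_gt0 lt_neqAle Adi.
- by rewrite scalerN -scaleNr; exists (- s).
Qed.

(** Induction on the number of constraints that are not active at the
    minimizer: as long as it is not extremal, it can be moved without changing
    the objective so that this number decreases. *)
Lemma exists_extremal_minimizer {c x} : \rank A = n ->
  attains_min_at (inner c) E x ->
  exists2 w, extremal_points E w & attains_min_at (inner c) E w.
Proof.
move=> rankA; have [k] := ubnP (m - #|active x|)%N.
elim: k x => // k IHk x xk minx; have [Ex lex] := minx.
have [extx|next] := pselect (extremal_points E x); first by exists x.
have [x1 [x2 [t [E1 E2 t01 xE x12]]]] : exists x1 x2 t,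
    [/\ E x1, E x2, 0 < t < 1, x = (1 - t) *: x1 + t *: x2 & x1 <> x2].
  apply: contra_notP next => noseg; split=> // x1 x2 t E1 E2 t01 xE.
  by apply: contra_notP noseg => x12; exists x1, x2, t.
(* The opposite of the objective is maximal at x, which is interior. *)
have cd0 : inner c (x2 - x1) = 0.
  have [||||e1 e2] := @convex_comb_eq_max _ (- inner c x1) (- inner c x2)
    (- inner c x) t; rewrite ?lerN2 ?lex//.
    by rewrite xE innerDr !innerZr; lra.
  by rewrite innerBr; lra.
have [s] := segment_exit rankA E1 E2 t01 x12; rewrite -xE => -[Ey acty].
apply: (IHk (x + s *: (x2 - x1))).
  have /fintype.proper_card lty := acty.
  have := fintype.max_card (mem (active (x + s *: (x2 - x1)))).
  rewrite card_ord => ley; apply: leq_trans (xk : (_ <= k)%N).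
  by rewrite ltn_sub2l// (leq_trans lty).
by split=> // y Ey'; rewrite innerDr innerZr cd0 mulr0 addr0 lex.
Qed.

End Polyhedron.

Theorem theorem2p4 (R : realType) (m n : nat) (A : 'M[R]_(m, n))
    (b : 'cV[R]_m) (c : 'cV[R]_n)
    (rankA : \rank A = n) (E_neq0 : polyhedron A b !=set0) :
  let E := polyhedron A b in
  let f := fun x : 'cV[R]_n => (c^T *m x) 0 0 in
  ((exists x0, attains_min_at f E x0) <->
     (\bigcup_(w in extremal_points E) normal_cone E w) (- c)) /\
  (forall w, extremal_points E w -> normal_cone E w (- c) ->
     attains_min_at f E w).
Proof.
move=> E f.
have vertex_min w :
    extremal_points E w -> normal_cone E w (- c) -> attains_min_at f E w.
  move=> [Ew _]; apply: normal_cone_attains_min => // x t Ex.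
  exact: polyhedron_convex.
split=> //; split=> [[x0 minx0]|[w extw Nw]]; last by exists w; exact: vertex_min.
have [w extw minw] := exists_extremal_minimizer rankA minx0.
by exists w => //; exact: attains_min_normal_cone.
Qed.
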